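(* Let $A$ and $B$ be unital locally matrix algebras over a field $\mathbb{F}$ whose characteristic is not $2$. If a surjective $\mathbb{F}$-linear mapping $\varphi : A \to B$ preserves the normalized rank, then there exist a mapping $\psi : A \to B$ that is an isomorphism or an antiisomorphism of algebras, and invertible elements $X, Y \in B$, such that $\varphi(a) = X\,\psi(a)\,Y$ for all $a \in A$.
   Context: An associative $\mathbb{F}$-algebra $A$ is a locally matrix algebra if every finite subset of $A$ is contained in a subalgebra isomorphic to a matrix algebra $M_n(\mathbb{F})$ for some $n$; it is unital if it contains an identity element $1_A$. Normalized rank: let $A$ be a unital locally matrix algebra. For $a \in A$ choose a subalgebra $A' \subset A$ containing $1_A$ and $a$ with $A' \cong M_n(\mathbb{F})$; put $\overline{r}(a) = r(a)/n$, where $r(a)$ is the rank of $a$ as an $n\times n$ matrix. This does not depend on the choice of $A'$. A linear mapping $\varphi: A \to B$ of unital locally matrix algebras preserves the normalized rank if $\overline{r}(\varphi(a)) = \overline{r}(a)$ for all $a \in A$. An antihomomorphism $\psi : A \to B$ of associative algebras is a linear mapping with $\psi(a_1 a_2) = \psi(a_2)\psi(a_1)$ for all $a_1, a_2 \in A$; an antiisomorphism is a bijective antihomomorphism. *)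

(* Defs.v *)
From HB Require Import structures.
From mathcomp Require Import all_boot all_order all_algebra.
From mathcomp Require Import boolp classical_sets functions cardinality.

Set Implicit Arguments.
Unset Strict Implicit.
Unset Printing Implicit Defensive.

Import GRing.Theory.
Local Open Scope classical_set_scope.
Local Open Scope ring_scope.

(* Subalgebras are not required to contain the identity of the algebra. *)
Definition is_subalgebra (F : fieldType) (A : algType F) (S : set A) : Prop :=
  [/\ S 0,
      forall (c : F) (u v : A), S u -> S v -> S (c *: u + v)
    & forall u v : A, S u -> S v -> S (u * v)].

(* f, viewed as a map onto S, is an isomorphism of algebras M_n(F) -> S.
   It need not send 1%:M to 1, hence it is not asked to be an lrmorphism. *)
Definition matrix_iso (F : fieldType) (A : algType F) (n : nat) (S : set A)
    (f : {linear 'M[F]_n -> A}) : Prop :=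
  [/\ {morph f : M N / M *m N >-> M * N}, injective f & range f = S].

(* An algType is a nontrivial algebra with an identity, so that this is the
   notion of a unital locally matrix algebra. *)
Definition locally_matrix (F : fieldType) (A : algType F) : Prop :=
  forall X : set A, finite_set X ->
  exists S : set A, [/\ is_subalgebra S, X `<=` S
    & exists2 n : nat, (0 < n)%N
      & exists f : {linear 'M[F]_n -> A}, matrix_iso S f].

Definition is_nrank (F : fieldType) (A : algType F) (a : A) (q : rat) : Prop :=
  exists S : set A, [/\ is_subalgebra S, S 1, S a
    & exists2 n : nat, (0 < n)%N
      & exists2 f : {linear 'M[F]_n -> A}, matrix_iso S f
        & exists2 M : 'M[F]_n, f M = a & q = (\rank M)%:R / n%:R].

(* In a locally matrix algebra exactly one q satisfies is_nrank a q; the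
   default value 0 is only used outside of that setting. *)
Definition nrank (F : fieldType) (A : algType F) (a : A) : rat :=
  xget 0 [set q | is_nrank a q].

Definition preserves_nrank (F : fieldType) (A B : algType F)
    (phi : A -> B) : Prop :=
  forall a : A, nrank (phi a) = nrank a.

Definition alg_isomorphism (F : fieldType) (A B : algType F)
    (psi : {linear A -> B}) : Prop :=
  {morph psi : x y / x * y} /\ bijective psi.

Definition alg_antiisomorphism (F : fieldType) (A B : algType F)
    (psi : {linear A -> B}) : Prop :=
  {morph psi : x y / x * y >-> y * x} /\ bijective psi.

Definition invertible (F : fieldType) (A : algType F) (x : A) : Prop :=
  exists y : A, y * x = 1 /\ x * y = 1.

(* Main.v *)
Require Import Defs.
From mathcomp Require Import all_boot all_order all_algebra.
From mathcomp Require Import boolp classical_sets cardinality.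

(* After left multiplication by phi(1)^-1 the map is unital.  An element p is
   idempotent iff the normalized ranks of p and 1 - p add up to 1, so the
   unital map psi preserves idempotents.  On each matrix subalgebra the
   bilinear map psi(MN) - psi(M) psi(N) vanishes on the diagonal at idempotents,
   hence on the whole diagonal, so psi is a Jordan homomorphism.  Locally matrix
   algebras are prime, and a Jordan homomorphism onto a 2-torsion-free prime
   ring is a homomorphism or an antihomomorphism (Herstein, Smiley). *)

Set Implicit Arguments.
Unset Strict Implicit.
Unset Printing Implicit Defensive.

Import Order.TTheory GRing.Theory Num.Theory.
Local Open Scope ring_scope.

(** * Ranks of idempotents and of morphisms between matrix algebras; bilinear maps vanishing at
    idempotents *)

Section MatrixRank.
Variable F : fieldType.

(** The kernel of [P] always lies in the row space of [1%:M - P], and idempotency is the reverse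
    inclusion; as the kernel has rank [n - \rank P], this is a rank count. *)
Lemma idempotent_mxrank n (P : 'M[F]_n) :
  P *m P = P <-> (\rank P + \rank (1%:M - P)%R)%N = n.
Proof.
have kerS : (kermx P <= 1%:M - P)%MS.
  apply/submxP; exists (kermx P).
  by rewrite mulmxBr mulmx1 mulmx_ker subr0.
split=> [idP | rkP].
  have Sker : (1%:M - P <= kermx P)%MS.
    by apply/sub_kermxP; rewrite mulmxBl mul1mx idP subrr.
  have /eqmx_rank-> : (1%:M - P == kermx P)%MS by rewrite Sker kerS.
  by rewrite mxrank_ker subnKC ?rank_leq_row.
have : (1%:M - P <= kermx P)%MS.
  by rewrite -(geq_leqif (mxrank_leqif_sup kerS)) mxrank_ker leq_subRL ?rank_leq_row ?rkP.
by move/sub_kermxP; rewrite mulmxBl mul1mx => /subr0_eq.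
Qed.

(** Since [P = P *m (P + Q)], and likewise for [Q], the row space of [P + Q] is the sum of the two
    row spaces, which meet trivially. *)
Lemma mxrank_add_orthogonal n (P Q : 'M[F]_n) :
    P *m P = P -> Q *m Q = Q -> P *m Q = 0 -> Q *m P = 0 ->
  \rank (P + Q)%R = (\rank P + \rank Q)%N.
Proof.
move=> idP idQ PQ0 QP0.
have capPQ : (P :&: Q)%MS = 0.
  apply/eqP; rewrite -submx0; apply/rV_subP => u.
  rewrite sub_capmx => /andP[/submxP[a ->] /submxP[b eqab]].
  by rewrite submx0 -idP mulmxA eqab -mulmxA QP0 mulmx0.
rewrite -(mxrank_disjoint_sum capPQ).
apply/eqmx_rank/andP; split; first by rewrite addmx_sub_adds.
rewrite addsmx_sub; apply/andP; split; apply/submxP.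
  by exists P; rewrite mulmxDr idP PQ0 addr0.
by exists Q; rewrite mulmxDr idQ QP0 add0r.
Qed.

(** For [n > 0], the images of the diagonal matrix units are orthogonal idempotents of a common rank
    [rho], so their ranks add up, and [g 1%:M = 1%:M] gives [k = n * rho]. Invertible factors, which
    [g] preserves, reduce any matrix to some [pid_mx r]. *)
Lemma mxrank_unital_morph n k (g : 'M[F]_n -> 'M[F]_k) :
    {morph g : M N / M + N} -> {morph g : M N / M *m N} -> g 1%:M = 1%:M ->
  forall M, (\rank (g M) * n = \rank M * k)%N.
Proof.
move=> gD gM g1.
have g0 : g 0 = 0 by apply: (@addIr _ (g 0)); rewrite -gD !add0r.
case: n => [|n] in g gD gM g1 g0 *.
  by move=> M; rewrite (thinmx0 M) mxrank0 muln0.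
have rk_le i j : (\rank (g (delta_mx i i)) <= \rank (g (delta_mx j j)))%N.
  have -> : delta_mx i i = delta_mx i j *m (delta_mx j j *m delta_mx j i) :> 'M[F]_n.+1.
    by rewrite !mul_delta_mx.
  by rewrite !gM (leq_trans (mxrankM_maxr _ _)) // mxrankM_maxl.
pose rho := \rank (g (delta_mx 0 0)).
have rk_delta i : \rank (g (delta_mx i i)) = rho.
  by apply/eqP; rewrite eqn_leq !rk_le.
have rk_pid r : (r <= n.+1)%N -> \rank (g (pid_mx r)) = (r * rho)%N.
  elim: r => [|r IHr] ltrn; first by rewrite pid_mx_0 g0 mxrank0.
  pose i := Ordinal ltrn.
  have -> : pid_mx r.+1 = pid_mx r + delta_mx i i :> 'M[F]_n.+1.
    apply/matrixP => a b; rewrite !mxE -natrD; congr _%:R.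
    rewrite -!val_eqE /= ltnS.
    case: (eqVneq (a : nat) b) => [<-|neq_ab]; first by rewrite andbb; case: ltngtP.
    by have [ar|//] := eqVneq (a : nat) r; rewrite -ar eq_sym (negPf neq_ab).
  have ort1 : pid_mx r *m delta_mx i i = 0 :> 'M[F]_n.+1.
    apply/matrixP => a b; rewrite !mxE big1 // => c _; rewrite !mxE -val_eqE /=.
    have [->|//] := eqVneq (c : nat) r; last by rewrite mulr0.
    by have [->|//] := eqVneq (a : nat) r; rewrite ?ltnn ?mul0r.
  have ort2 : delta_mx i i *m pid_mx r = 0 :> 'M[F]_n.+1.
    by apply: trmx_inj; rewrite trmx_mul tr_pid_mx trmx_delta ort1 trmx0.
  rewrite gD mxrank_add_orthogonal -?gM ?ort1 ?ort2 ?mul_delta_mx //.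
    by rewrite IHr ?rk_delta 1?ltnW // mulSn addnC.
  by rewrite pid_mx_id // ltnW.
have kE : k = (n.+1 * rho)%N.
  by rewrite -rk_pid // pid_mx_1 g1 mxrank1.
have g_unit P : P \in unitmx -> g P \in unitmx.
  move=> uP; suff /mulmx1_unit[] : g P *m g (invmx P) = 1%:M by [].
  by rewrite -gM mulmxV.
move=> M; rewrite -{1}(mulmx_ebase M) !gM.
rewrite mxrankMfree ?row_free_unit ?g_unit ?row_ebase_unit //.
rewrite (eqmxMfull _ _) ?row_full_unit ?g_unit ?col_ebase_unit //.
by rewrite rk_pid ?rank_leq_row // kE -mulnA [(rho * _)%N]mulnC.
Qed.

(* Rank-one matrices [u *m v] are handled first: polarizing
   [C (u *m v) (u *m v) = 0] makes [C + C^T] antisymmetric in [u, u'] and in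
   [v, v'], which reduces the claim to orthogonal pairs of rank-one
   idempotents. *)
Lemma alternating_of_idempotents n (V : lmodType F)
    (C : 'M[F]_n -> 'M[F]_n -> V) :
    2%N \notin [pchar F] ->
    (forall M, linear (C M)) -> (forall N, linear (C^~ N)) ->
    (forall P, P *m P = P -> C P P = 0) ->
  forall M, C M M = 0.
Proof.
move=> char2 linr linl Cidem.
have two_neq0 : (2%:R : F) != 0 by apply: contra char2; rewrite inE.
have half (x : V) : x + x = 0 -> x = 0.
  rewrite -mulr2n -scaler_nat => /eqP.
  by rewrite scaler_eq0 (negPf two_neq0) => /eqP.
have CDr M N N' : C M (N + N') = C M N + C M N'.
  by have := linr M 1 N N'; rewrite !scale1r.
have CDl M M' N : C (M + M') N = C M N + C M' N.
  by have := linl N 1 M M'; rewrite !scale1r.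
have C0r M : C M 0 = 0 by apply: (@addIr _ (C M 0)); rewrite -CDr !add0r.
have C0l N : C 0 N = 0 by apply: (@addIr _ (C 0 N)); rewrite -CDl !add0r.
have CZr a M N : C M (a *: N) = a *: C M N.
  by have := linr M a N 0; rewrite !addr0 C0r addr0.
have CZl a M N : C (a *: M) N = a *: C M N.
  by have := linl N a M 0; rewrite !addr0 C0l addr0.
pose D M N := C M N + C N M.
have DC M N : D M N = D N M by rewrite /D addrC.
have DDl M M' N : D (M + M') N = D M N + D M' N.
  by rewrite /D CDl CDr addrACA.
have DDr M N N' : D M (N + N') = D M N + D M N'.
  by rewrite DC DDl !(DC M).
have CD M N : C (M + N) (M + N) = C M M + C N N + D M N.
  by rewrite CDl !CDr -!addrA; congr (_ + _); rewrite [RHS]addrC addrA.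
have C_rank1 (u : 'cV_n) (v : 'rV_n) : C (u *m v) (u *m v) = 0.
  (* If [w *m u] is a nonzero scalar [c], then [c^-1 *: (u *m w)] is idempotent. *)
  have C_nz (w : 'rV_n) : w *m u != 0 -> C (u *m w) (u *m w) = 0.
    move=> wu_neq0; set c := (w *m u) 0 0.
    have wuE : w *m u = c%:M by rewrite [LHS]mx11_scalar.
    have c_neq0 : c != 0 by apply: contraNneq wu_neq0; rewrite wuE => ->; rewrite raddf0.
    have : C (c^-1 *: (u *m w)) (c^-1 *: (u *m w)) = 0.
      apply: Cidem; rewrite -scalemxAl -scalemxAr mulmxA -(mulmxA u) wuE.
      by rewrite mul_mx_scalar -scalemxAl scalerA mulVf // scale1r.
    move/eqP; rewrite CZl CZr !scaler_eq0 invr_eq0 (negPf c_neq0) /=.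
    by move/eqP.
  have [vu0 | /C_nz//] := eqVneq (v *m u) 0.
  have [-> | u_neq0] := eqVneq u 0; first by rewrite mul0mx C0l.
  have [i ui_neq0] : exists i, u i 0 != 0.
    by apply/cV0Pn.
  (* As [w *m u != 0] and [v *m u = 0], both [w + v] and [w - v] fall under [C_nz]; adding the two
     expansions cancels the cross terms and leaves [C (u *m v) (u *m v)] twice. *)
  pose w : 'rV[F]_n := delta_mx 0 i.
  have wu_neq0 : w *m u != 0.
    by rewrite -rowE; apply/rV0Pn; exists 0; rewrite mxE.
  have plus : C (u *m (w + v)) (u *m (w + v)) = 0.
    by apply: C_nz; rewrite mulmxDl vu0 addr0.
  have minus : C (u *m (w + (-1) *: v)) (u *m (w + (-1) *: v)) = 0.
    by apply: C_nz; rewrite mulmxDl -scalemxAl vu0 scaler0 addr0.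
  move: plus minus; rewrite !mulmxDr !CD -scalemxAr.
  rewrite (C_nz w) // !add0r CZl CZr scalerA mulrNN mulr1 scale1r.
  rewrite /D CZl CZr -scalerDr scaleN1r; set d := C _ _ + C _ _ => pl mi.
  have := congr2 +%R pl mi; rewrite addrACA subrr !addr0.
  exact: half.
have D_l u (v v' : 'rV_n) : D (u *m v) (u *m v') = 0.
  by have := C_rank1 u (v + v'); rewrite mulmxDr CD !C_rank1 !add0r.
have D_r (u u' : 'cV_n) v : D (u *m v) (u' *m v) = 0.
  by have := C_rank1 (u + u') v; rewrite mulmxDl CD !C_rank1 !add0r.
(* The sum of two orthogonal idempotents is idempotent, and [D] is the cross term of its
   expansion. *)
have D_orth u (v : 'rV_n) u' (v' : 'rV_n) :
    v *m u = 1%:M -> v' *m u' = 1%:M -> v *m u' = 0 -> v' *m u = 0 ->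
    D (u *m v) (u' *m v') = 0.
  move=> vu v'u' vu' v'u.
  have := Cidem (u *m v + u' *m v'); rewrite CD !C_rank1 !add0r; apply.
  rewrite mulmxDl !mulmxDr !mulmxA -!(mulmxA u) -!(mulmxA u') vu v'u' vu' v'u.
  by rewrite !mul1mx !mul0mx !mulmx0 addr0 add0r.
pose e i : 'rV[F]_n := delta_mx 0 i.
pose d i : 'cV[F]_n := delta_mx i 0.
have ed i j : e i *m d j = (i == j)%:R%:M.
  by rewrite mul_delta_mx_cond; apply/matrixP => x y; case: eqVneq => _; rewrite !ord1 !mxE.
have dE i j : delta_mx i j = d i *m e j by rewrite mul_delta_mx.
have D_delta i j k l : D (delta_mx i j) (delta_mx k l) = 0.
  rewrite !dE; have [-> | neq_ik] := eqVneq i k; first exact: D_l.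
  (* The form [a] is alternating by [D_r]. If [x] and [y] are killed by [d i] and [d k], then
     [e i + x], [e k + y] are dual to [d i], [d k], so [D_orth] applies; expanding settles the
     remaining pairs of basis rows. *)
  pose a v v' := D (d i *m v) (d k *m v').
  have aDl v1 v2 v : a (v1 + v2) v = a v1 v + a v2 v by rewrite /a mulmxDr DDl.
  have aDr v1 v2 v : a v (v1 + v2) = a v v1 + a v v2 by rewrite /a mulmxDr DDr.
  have aN v v' : a v v' = 0 -> a v' v = 0.
    by have := D_r (d i) (d k) (v + v'); rewrite -/(a _ _) aDl !aDr /a !D_r add0r addr0 => + vv'0; rewrite vv'0 add0r.
  have aE x y : x *m d i = 0 -> x *m d k = 0 -> y *m d i = 0 -> y *m d k = 0 ->
      a (e i + x) (e k + y) = 0.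
    move=> xi xk yi yk; apply: D_orth; rewrite mulmxDl ed ?xi ?xk ?yi ?yk addr0 ?eqxx //.
      by rewrite (negPf neq_ik) raddf0.
    by rewrite eq_sym (negPf neq_ik) raddf0.
  have a_ik : a (e i) (e k) = 0.
    by have := aE 0 0; rewrite !addr0 !mul0mx; apply.
  have a_ix x : x *m d i = 0 -> x *m d k = 0 -> a (e i) x = 0.
    move=> xi xk; have := aE 0 x; rewrite !mul0mx addr0 aDr a_ik add0r.
    by apply.
  have a_xk x : x *m d i = 0 -> x *m d k = 0 -> a x (e k) = 0.
    move=> xi xk; have := aE x 0; rewrite !mul0mx addr0 aDl a_ik add0r.
    by apply.
  have a_xy x y : x *m d i = 0 -> x *m d k = 0 -> y *m d i = 0 -> y *m d k = 0 ->
      a x y = 0.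
    move=> xi xk yi yk; have := aE x y xi xk yi yk.
    by rewrite aDl !aDr a_ik a_ix // a_xk // !add0r.
  have e0 m r : m != r -> e m *m d r = 0 by move=> /negPf mr; rewrite ed mr raddf0.
  rewrite -/(a (e j) (e l)).
  have [->{j} | ji] := eqVneq j i; have [->{l} | li] := eqVneq l i.
  - by rewrite /a D_r.
  - by have [->|lk] := eqVneq l k; rewrite ?a_ik // a_ix ?e0.
  - by have [->|jk] := eqVneq j k; apply: aN; rewrite ?a_ik // a_ix ?e0.
  have [->{j ji} | jk] := eqVneq j k; have [->{l li} | lk] := eqVneq l k.
  - by rewrite /a D_r.
  - by apply: aN; rewrite a_xk ?e0.
  - by rewrite a_xk ?e0.
  - by rewrite a_xy ?e0.
(* [D M M] is twice [C M M]; both arguments are expanded in matrix units. *)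
move=> M; apply: half; rewrite -/(D M M).
have Dsum I (r : seq I) (G : I -> 'M[F]_n) N :
    (forall i, D (G i) N = 0) -> D (\sum_(i <- r) G i) N = 0.
  move=> G0; elim: r => [|x r IHr]; first by rewrite big_nil /D C0l C0r addr0.
  by rewrite big_cons DDl G0 IHr addr0.
have DZl c N N' : D N N' = 0 -> D (c *: N) N' = 0.
  by rewrite /D CZl CZr -scalerDr => ->; rewrite scaler0.
rewrite {1}[M]matrix_sum_delta; apply: (Dsum) => ?; apply: (Dsum) => ?; apply: (DZl).
rewrite DC [M]matrix_sum_delta; apply: (Dsum) => ?; apply: (Dsum) => ?; apply: (DZl).
exact: D_delta.
Qed.

End MatrixRank.

(** * Jordan homomorphisms onto prime rings without 2-torsion *)

Section JordanHomomorphism.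
Variables (A B : nzRingType) (psi : {additive A -> B}).
Hypothesis two_reg : forall x : B, x + x = 0 -> x = 0.
Hypothesis primeB : forall x y : B, (forall s, x * s * y = 0) -> x = 0 \/ y = 0.
Hypothesis psi_surj : forall b, exists a, psi a = b.
Hypothesis psi_sqr : forall a, psi (a * a) = psi a * psi a.

Let psi_jordan x y : psi (x * y) + psi (y * x) = psi x * psi y + psi y * psi x.
Proof.
have := psi_sqr (x + y); rewrite mulrDl !mulrDr !raddfD /= mulrDl !mulrDr.
rewrite !psi_sqr -!addrA => /addrI; rewrite !addrA => /addIr.
by [].
Qed.

(** With [{x, y} = x y + y x], one has [{x, {x, y}} = {x x, y} + 2 x y x], so twice [x y x] is
    expressed through operations that [psi] respects; then 2 is cancelled in [B]. *)
Let psi_mul3 x y : psi (x * y * x) = psi x * psi y * psi x.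
Proof.
have group (V : zmodType) (a b c : V) : a + b + (b + c) = a + c + (b + b).
  by rewrite [b + c]addrC addrACA.
have := psi_jordan x (x * y + y * x).
have -> : psi (x * y + y * x) = psi x * psi y + psi y * psi x by rewrite raddfD psi_jordan.
rewrite !mulrDl !mulrDr !raddfD /= !mulrA group [RHS]group.
have := psi_jordan (x * x) y; rewrite psi_sqr !mulrA => -> /addrI dbl.
apply/subr0_eq/two_reg.
by rewrite addrACA -opprD dbl subrr.
Qed.

Let psi_mul3_sym x y z :
  psi (x * y * z) + psi (z * y * x) = psi x * psi y * psi z + psi z * psi y * psi x.
Proof.
have := psi_mul3 (x + z) y.
rewrite !raddfD /= !mulrDl !mulrDr !raddfD /= !psi_mul3 -!addrA => /addrI.
by rewrite !addrA => /addIr; rewrite addrC => ->; rewrite addrC.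
Qed.

Let sandwich (x y : B) : (forall s, x * s * y + y * s * x = 0) -> x = 0 \/ y = 0.
Proof.
move=> symxy; have [y0 | y_neq0] := eqVneq y 0; [by right | left].
(* Put [P = x s x t y], [Q = y s x t x], [R = x s y t x]. The hypothesis gives
   [P + Q = R + Q = P + R = 0], hence [2 P = 0]. *)
have xsxty s t : x * s * x * t * y = 0.
  have PQ := symxy (s * x * t).
  have RQ := congr1 (fun z => z * t * x) (symxy s).
  have PR := congr1 (fun z => x * s * z) (symxy t).
  move: PQ RQ PR; rewrite /= !(mulrDl, mulrDr, mulrA, mul0r, mulr0) => PQ RQ PR.
  apply: two_reg; rewrite -[RHS]PR; congr (_ + _).
  by apply: addIr (etrans PQ (esym RQ)).
suff : x = 0 \/ x = 0 by case.
apply: primeB => s; case: (primeB (xsxty s)) => // y0.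
by rewrite y0 eqxx in y_neq0.
Qed.

(* Writing [u = psi (a b)], [v = psi (b a)], [p = psi a psi b] and
   [q = psi b psi a], one has [u + v = p + q], and [T u v = T p q] for the
   symmetric form [T x y = x s y + y s x]; hence [T (u - p) (u - q) = 0]. *)
Let psi_mul_or a b :
  psi (a * b) = psi a * psi b \/ psi (a * b) = psi b * psi a.
Proof.
suff /sandwich[] : forall s,
    (psi (a * b) - psi a * psi b) * s * (psi (a * b) - psi b * psi a) +
    (psi (a * b) - psi b * psi a) * s * (psi (a * b) - psi a * psi b) = 0.
- by move/subr0_eq; left.
- by move/subr0_eq; right.
move=> s; have [r <-] := psi_surj s.
pose T x y := x * psi r * y + y * psi r * x.
have TC x y : T x y = T y x by rewrite /T addrC.
have TDr x y z : T x (y + z) = T x y + T x z.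
  by rewrite /T mulrDr !mulrDl addrACA.
have TNr x y : T x (- y) = - T x y by rewrite /T mulrN !mulNr opprD.
(* The image of [a b r b a + b a r a b] is computed with two bracketings: [(a b) r (b a)] and
   [a (b r b) a]. *)
have Tuv : T (psi (a * b)) (psi (b * a)) = T (psi a * psi b) (psi b * psi a).
  rewrite /T -psi_mul3_sym.
  have -> : a * b * r * (b * a) = a * (b * r * b) * a by rewrite !mulrA.
  have -> : b * a * r * (a * b) = b * (a * r * a) * b by rewrite !mulrA.
  by rewrite !psi_mul3 !mulrA.
have := psi_jordan a b.
move: Tuv; set u := psi (a * b); set v := psi (b * a).
set p := psi a * psi b; set q := psi b * psi a => Tuv uv.
have := congr1 (T u) uv; rewrite !TDr => TuE.
rewrite -/(T (u - p) (u - q)) TDr TNr ![T (u - p) _]TC !TDr !TNr opprB.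
by rewrite [T q p]TC -Tuv [T q u]TC addrACA TuE -opprD subrr.
Qed.

(** A group is not the union of two proper subgroups. Applied to the second factor and then to the
    first, this makes the alternative in [psi_mul_or] independent of the pair. *)
Lemma jordan_hom_or_antihom :
  {morph psi : x y / x * y} \/ {morph psi : x y / x * y >-> y * x}.
Proof.
have cover (V : zmodType) (P Q : V -> Prop) :
    (forall x y, P x -> P y -> P (x - y)) -> (forall x y, Q x -> Q y -> Q (x - y)) ->
    (forall x, P x \/ Q x) -> (forall x, P x) \/ (forall x, Q x).
  move=> PB QB PQ; have [|/existsNP[x nPx]] := pselect (forall x, P x); first by left.
  have [|/existsNP[y nQy]] := pselect (forall x, Q x); first by right.
  have Qx : Q x by case: (PQ x).
  have Py : P y by case: (PQ y).
  case: (PQ (x + y)) => [/PB/(_ Py) | /QB/(_ Qx)]; first by rewrite addrK.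
  by rewrite addrC addKr.
apply: (cover A (fun x => forall y, psi (x * y) = psi x * psi y)
  (fun x => forall y, psi (x * y) = psi y * psi x)) => [x y hx hy z | x y hx hy z | a].
- by rewrite mulrBl !raddfB /= hx hy mulrBl.
- by rewrite mulrBl !raddfB /= hx hy mulrBr.
apply: cover _ _ (psi_mul_or a) => [x y hx hy | x y hx hy].
- by rewrite mulrBr !raddfB /= hx hy mulrBr.
- by rewrite mulrBr !raddfB /= hx hy mulrBl.
Qed.

End JordanHomomorphism.

(** * Unital matrix subalgebras, normalized rank and primeness of locally matrix algebras *)

Section LocallyMatrix.
Variables (F : fieldType) (A : algType F).

Definition unital_embedding n (f : {linear 'M[F]_n -> A}) : Prop :=
  [/\ {morph f : M N / M *m N >-> M * N}, injective f & f 1%:M = 1].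

(** [f 1%:M] is an identity for [S], and [S] contains [1]. *)
Lemma matrix_iso_unital (S : set A) n (f : {linear 'M[F]_n -> A}) :
  S 1 -> matrix_iso S f -> unital_embedding f.
Proof.
move=> S1 [fM f_inj fS]; split=> //.
have [M _ fM1] : range f 1 by rewrite fS.
by rewrite -[LHS]mulr1 -fM1 -fM mul1mx.
Qed.

Lemma unital_embedding_gt0 n (f : {linear 'M[F]_n -> A}) :
  unital_embedding f -> (0 < n)%N.
Proof.
case: n f => // f [_ _ f1]; have := oner_eq0 A.
by rewrite -f1 (thinmx0 1%:M) raddf0 eqxx.
Qed.

(** The condition on matrix units, a finite family, puts the range of [f] inside that of [h]; then
    [h^-1 f] is a unital morphism of matrix rings, which scales ranks by [k / n]. *)
Lemma unital_embeddings_rank n k (f : {linear 'M[F]_n -> A})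
    (h : {linear 'M[F]_k -> A}) :
    unital_embedding f -> unital_embedding h ->
    (forall i j, exists N, h N = f (delta_mx i j)) ->
  forall M, exists2 N, h N = f M & (\rank N * n = \rank M * k)%N.
Proof.
move=> [fM f_inj f1] [hM h_inj h1] fh_delta.
have /choice[g0 g0E] : forall p : 'I_n * 'I_n, exists N, h N = f (delta_mx p.1 p.2).
  by move=> p; apply: fh_delta.
pose g (M : 'M_n) := \sum_i \sum_j M i j *: g0 (i, j).
have gE M : h (g M) = f M.
  rewrite [in RHS](matrix_sum_delta M) !raddf_sum /=; apply: eq_bigr => i _.
  by rewrite !raddf_sum /=; apply: eq_bigr => j _; rewrite !linearZ /= g0E.
move=> M; exists (g M) => //; move: M.
apply: mxrank_unital_morph => [X Y|X Y|]; apply: h_inj.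
- by rewrite raddfD /= !gE raddfD.
- by rewrite hM !gE fM.
- by rewrite gE f1 h1.
Qed.

Hypothesis locA : locally_matrix A.

Lemma locally_matrix_cover (s : seq A) :
  exists n, exists2 f : {linear 'M[F]_n -> A}, unital_embedding f &
    forall x, x \in s -> exists M, f M = x.
Proof.
(* Adding [1] to the list forces the matrix subalgebra to be unital. *)
have [S [_ sS [n _ [f fS]]]] := locA (finite_seq (1 :: s)).
have S1 : S 1 by apply: sS; rewrite /= mem_head.
exists n; exists f; first exact: matrix_iso_unital fS.
move=> x xs; have : S x by apply: sS; rewrite /= inE xs orbT.
by case: fS => _ _ <- [M _ <-]; exists M.
Qed.

Lemma nrank_embedding n (f : {linear 'M[F]_n -> A}) M :
  unital_embedding f -> nrank (f M) = (\rank M)%:R / n%:R.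
Proof.
move=> fU; have n_gt0 := unital_embedding_gt0 fU.
apply: xget_unique.
  exists (range f); split; last first.
  - exists n => //; exists f; last by exists M.
    by case: fU.
  - by exists M.
  - by case: fU => _ _ <-; exists 1%:M.
  split; first by exists 0; rewrite ?raddf0.
    by move=> c _ _ [M1 _ <-] [M2 _ <-]; exists (c *: M1 + M2); rewrite ?linearP.
  case: fU => fM _ _.
  by move=> _ _ [M1 _ <-] [M2 _ <-]; exists (M1 *m M2); rewrite ?fM.
move=> _ [S [_ S1 _ [m m_gt0 [h hS [N hN ->]]]]].
have hU := matrix_iso_unital S1 hS.
(* The ranges of [f] and [h] need not be comparable, so both are embedded in a third matrix
   subalgebra containing all their matrix units. *)
have [k [e eU es]] := locally_matrix_cover
  ([seq f (delta_mx p.1 p.2) | p : 'I_n * 'I_n] ++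
   [seq h (delta_mx p.1 p.2) | p : 'I_m * 'I_m]).
have k_gt0 := unital_embedding_gt0 eU.
have fe i j : exists N, e N = f (delta_mx i j).
  by apply: es; rewrite mem_cat; apply/orP; left; apply/fintype.imageP; exists (i, j).
have he i j : exists N, e N = h (delta_mx i j).
  by apply: es; rewrite mem_cat; apply/orP; right; apply/fintype.imageP; exists (i, j).
have [P eP rkP] := unital_embeddings_rank fU eU fe M.
have [Q eQ rkQ] := unital_embeddings_rank hU eU he N.
have PQ : P = Q by case: eU => _ e_inj _; apply: e_inj; rewrite eP -hN -eQ.
rewrite {}PQ in rkP.
apply/eqP; rewrite eqr_div ?pnatr_eq0 -?lt0n // -!natrM eqr_nat.
rewrite -(eqn_pmul2r k_gt0) mulnAC -rkQ [X in _ == X]mulnAC -rkP.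
by rewrite mulnAC.
Qed.

Lemma nrank_eq1 (a : A) : nrank a = 1 -> invertible a.
Proof.
have [n [f fU /(_ a)]] := locally_matrix_cover [:: a].
rewrite mem_head => /(_ isT)[M <-]; rewrite nrank_embedding // => /divr1_eq/eqP.
rewrite eqr_nat -/(row_free M) row_free_unit => uM.
case: fU => fM _ f1; exists (f (invmx M)).
by rewrite -!fM mulVmx // mulmxV.
Qed.

Lemma nrank1 : nrank (1 : A) = 1.
Proof.
have [n [f fU _]] := locally_matrix_cover [::].
have n_gt0 := unital_embedding_gt0 fU.
have [_ _ <-] := fU; rewrite nrank_embedding // mxrank1 divff //.
by rewrite pnatr_eq0 -lt0n.
Qed.

Lemma nrank_eq0 (a : A) : nrank a = 0 -> a = 0.
Proof.
have [n [f fU /(_ a)]] := locally_matrix_cover [:: a].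
have n_gt0 := unital_embedding_gt0 fU.
rewrite mem_head => /(_ isT)[M <-]; rewrite nrank_embedding // => /eqP.
rewrite mulf_eq0 invr_eq0 !pnatr_eq0 mxrank_eq0 (gtn_eqF n_gt0) orbF.
by move/eqP->; rewrite raddf0.
Qed.

Lemma nrank0 : nrank (0 : A) = 0.
Proof.
have [n [f fU _]] := locally_matrix_cover [::].
by rewrite -(raddf0 f) nrank_embedding // mxrank0 mul0r.
Qed.

(** Inside a matrix subalgebra containing [x], [y] and [a], the one-sided inverse makes [x] an
    invertible matrix. *)
Lemma nrank_mull (x y a : A) : y * x = 1 -> nrank (x * a) = nrank a.
Proof.
have [n [f fU fs]] := locally_matrix_cover [:: x; y; a].
have [X <-] : exists M, f M = x by apply: fs; rewrite !inE eqxx.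
have [Y <-] : exists M, f M = y by apply: fs; rewrite !inE eqxx orbT.
have [M <-] : exists M, f M = a by apply: fs; rewrite !inE eqxx !orbT.
have [fM f_inj <-] := fU; rewrite -!fM => /f_inj /mulmx1_unit[_ uX].
by rewrite !nrank_embedding // (eqmxMfull _ _) // row_full_unit.
Qed.

Lemma nrank_idempotent (p : A) : p * p = p <-> nrank p + nrank (1 - p) = 1.
Proof.
have [n [f fU /(_ p)]] := locally_matrix_cover [:: p].
have n_gt0 := unital_embedding_gt0 fU.
have n_neq0 : n%:R != 0 :> rat by rewrite pnatr_eq0 -lt0n.
rewrite mem_head => /(_ isT)[P <-]; have [fM f_inj f1] := fU.
rewrite -f1 -raddfB /= -fM !nrank_embedding // -mulrDl -natrD.
split=> [/f_inj/idempotent_mxrank-> | /divr1_eq/eqP]; first by rewrite divff.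
by rewrite eqr_nat => /eqP/idempotent_mxrank->.
Qed.

Lemma locally_matrix_prime (x y : A) :
  (forall s, x * s * y = 0) -> x = 0 \/ y = 0.
Proof.
have [n [f fU fs]] := locally_matrix_cover [:: x; y].
have [X <-] : exists M, f M = x by apply: fs; rewrite !inE eqxx.
have [Y <-] : exists M, f M = y by apply: fs; rewrite !inE eqxx orbT.
have [fM f_inj f1] := fU => XsY.
have [->|/matrix0Pn[i [j Xij]]] := eqVneq X 0; first by left; rewrite raddf0.
have [->|/matrix0Pn[k [l Ykl]]] := eqVneq Y 0; first by right; rewrite raddf0.
(* The entry at [(i, l)] of this product is [X i j * Y k l], a product of nonzero scalars. *)
have : X *m delta_mx j k *m Y = 0 by apply: f_inj; rewrite !fM XsY raddf0.
move/matrixP/(_ i l); rewrite !mxE (bigD1 k) //= big1 => [|m mk].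
  rewrite !mxE (bigD1 j) //= big1 => [|m mj].
    by rewrite !mxE !eqxx mulr1 !addr0 => /eqP; rewrite mulf_eq0 (negPf Xij) (negPf Ykl).
  by rewrite !mxE (negPf mj) mulr0.
rewrite !mxE big1 ?mul0r // => r _.
by rewrite !mxE (negPf mk) andbF mulr0.
Qed.

End LocallyMatrix.

(** * From idempotents to squares, and the form of maps preserving the normalized rank *)

Lemma jordan_of_idempotents (F : fieldType) (A B : algType F)
    (psi : {linear A -> B}) :
    2%N \notin [pchar F] -> locally_matrix A ->
    (forall p, p * p = p -> psi p * psi p = psi p) ->
  forall a, psi (a * a) = psi a * psi a.
Proof.
move=> char2 locA psi_idem a.
have [n [f [fM _ _] /(_ a)]] := locally_matrix_cover locA [:: a].
rewrite mem_head => /(_ isT)[M <-]; rewrite -fM; apply/subr0_eq.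
pose C M N := psi (f (M *m N)) - psi (f M) * psi (f N).
rewrite -/(C M M); apply: alternating_of_idempotents => {M} [//|M c N N'|N c M M'|P idP].
- rewrite /C mulmxDr -scalemxAr !linearP /= mulrDr -scalerAr opprD addrACA.
  by rewrite scalerBr.
- rewrite /C mulmxDl -scalemxAl !linearP /= mulrDl -scalerAl opprD addrACA.
  by rewrite scalerBr.
by rewrite /C psi_idem -?fM idP ?subrr.
Qed.

Theorem corollary1 (F : fieldType) (A B : algType F)
    (charF : 2%N \notin [pchar F])
    (locA : locally_matrix A) (locB : locally_matrix B)
    (phi : {linear A -> B})
    (phi_surj : forall b : B, exists a : A, phi a = b)
    (phi_nrank : preserves_nrank phi) :
  exists (psi : {linear A -> B}) (X Y : B),
    [/\ alg_isomorphism psi \/ alg_antiisomorphism psi,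
        invertible X, invertible Y
      & forall a : A, phi a = X * psi a * Y].
Proof.
have [U [Uphi1 phi1U]] : invertible (phi 1).
  by apply: nrank_eq1 => //; rewrite phi_nrank nrank1.
pose psi : {linear A -> B} := U \*o phi.
have psi1 : psi 1 = 1 by [].
have psi_nrank a : nrank (psi a) = nrank a.
  by rewrite (@nrank_mull _ _ locB _ (phi 1)) ?phi_nrank.
have psi_surj b : exists a, psi a = b.
  have [a phia] := phi_surj (phi 1 * b); exists a.
  by rewrite /= phia mulrA Uphi1 mul1r.
have psi_idem p : p * p = p -> psi p * psi p = psi p.
  by move=> /(nrank_idempotent locA) rkp; apply/(nrank_idempotent locB);
     rewrite -psi1 -raddfB !psi_nrank.
(* Injectivity comes from the rank: an element of the kernel has normalized rank 0, hence is 0. *)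
have psi_bij : bijective psi.
  have [g gK] := choice psi_surj; exists g => // a.
  apply/subr0_eq/(nrank_eq0 locA); rewrite -psi_nrank raddfB /= -[U * _]/(psi _).
  by rewrite gK subrr nrank0.
have two_reg (x : B) : x + x = 0 -> x = 0.
  rewrite -mulr2n -scaler_nat => /eqP; rewrite scaler_eq0 => /orP[|/eqP//].
  by move=> two0; case/negP: charF; rewrite inE.
(* Left multiplication by [phi 1] undoes the normalization by [U], so [Y = 1]. *)
exists psi, (phi 1), 1; split.
- have [] := jordan_hom_or_antihom two_reg (locally_matrix_prime locB) psi_surj
    (jordan_of_idempotents charF locA psi_idem); by [left | right].
- by exists U.
- by exists 1; rewrite mulr1.
- by move=> a; rewrite mulr1 /= mulrA phi1U mul1r.
Qed.
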